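(* Let $m,n\ge1$ be integers and $d=m+n$. For a real $m\times n$ matrix $B$, an integer $N>0$, a real number $Q>0$ and a decreasing function $\varphi:\mathbb{R}_{>0}\to\mathbb{R}_{>0}$, consider the system of inequalities $$(\ast)\qquad \|B\mathbf n-\mathbf m\|_\infty^m<N^m\varphi(Q)\quad\text{and}\quad \|\mathbf n\|_\infty^n<(N/2)^nQ,$$ in unknowns $\mathbf m\in\mathbb{Z}^m$, $\mathbf n\in\mathbb{Z}^n$. Let $f:\mathbb{R}_{>0}\to\mathbb{R}_{>0}$ be an increasing function with $\sum_{k=1}^\infty 1/f(k)<\infty$. (i) For almost every $B$ and for every integer $N>0$ there is $Q_0=Q_0(B,N)$ such that for all $Q\ge Q_0$ and every decreasing $\varphi:\mathbb{R}_{>0}\to\mathbb{R}_{>0}$: if $$\varphi(Q)\ge Q^{-1}f(\log Q),$$ then $(\ast)$ has a solution $(\mathbf m,\mathbf n)\in\mathbb{Z}^d$ in every congruence class of $\mathbb{Z}^d$ modulo $N$. (ii) Suppose in addition that $f(x)$ grows at most polynomially in $x$. Then for almost every $B$ there is $Q_0=Q_0(B,f)$ such that for every $Q\ge Q_0$ there is $N_0=N_0(Q)$ such that for all integers $N\ge N_0$ and every decreasing $\varphi:\mathbb{R}_{>0}\to\mathbb{R}_{>0}$: if $$\varphi(Q)\le Q^{-1}\left(f(\log Q)\right)^{-\frac1m},$$ then $(\ast)$ fails to have a solution $(\mathbf m,\mathbf n)\in\mathbb{Z}^d$ in some congruence class of $\mathbb{Z}^d$ modulo $N$.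
   Context: ''Almost every $B$'' is with respect to Lebesgue measure on the space $\mathbb{R}^{m\times n}$ of real $m\times n$ matrices. A congruence class of $\mathbb{Z}^d$ modulo $N$ is a coset of $N\mathbb{Z}^d$ in $\mathbb{Z}^d$. $\|\cdot\|_\infty$ is the sup norm. ''$f$ grows at most polynomially'' means that there is $k>0$ with $f(x)<x^k$ for all sufficiently large $x$. The function $f$ and the integers $m,n$ are fixed, and thresholds (and exceptional null sets) may depend on them; the threshold $N_0(Q)$ may also depend on $B$. *)

(* Defs.v *)
From HB Require Import structures.
From mathcomp Require Import all_boot all_order all_algebra.
From mathcomp Require Import all_classical all_reals all_analysis.

Set Implicit Arguments.
Unset Strict Implicit.
Unset Printing Implicit Defensive.

Import Order.TTheory GRing.Theory Num.Theory.
Import numFieldNormedType.Exports.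

Local Open Scope classical_set_scope.
Local Open Scope ring_scope.

(** Lebesgue measure on R^k (on the Borel sets), as the k-fold product of the
    one-dimensional one; R^0 carries the unit mass at its only point. *)
Section lebesgue_tuple.
Context {R : realType}.
Local Notation RT := (measurableTypeR R).

Definition tcons k (p : RT * k.-tuple RT) : k.+1.-tuple RT :=
  [the k.+1.-tuple RT of p.1 :: p.2].

Fixpoint lebesgue_tuple k : set (k.-tuple RT) -> \bar R :=
  match k return set (k.-tuple RT) -> \bar R with
  | 0 => \d_ ([tuple] : 0.-tuple RT)
  | k'.+1 => pushforward (lebesgue_measure \x @lebesgue_tuple k')%E (@tcons k')
  end.

Lemma measurable_tcons k : measurable_fun [set: RT * k.-tuple RT] (@tcons k).
Proof. exact: measurable_cons. Qed.

Lemma measurable_tuple_box k (F : 'I_k -> set RT) :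
  (forall i, measurable (F i)) ->
  measurable [set t : k.-tuple RT | forall i, F i (tnth t i)].
Proof.
move=> mF.
rewrite (_ : [set _ | _] =
  \bigcap_(i in [set: 'I_k]) ((@tnth k RT)^~ i @^-1` F i)); last first.
  by apply/seteqP; split=> t /= h i; [move=> _|]; apply: h.
apply: fin_bigcap_measurable; first exact: finite_finset.
by move=> i _; rewrite -[_ @^-1` _]setTI; exact: measurable_tnth.
Qed.

Lemma tcons_box k (F : 'I_k.+1 -> set RT) :
  @tcons k @^-1` [set t | forall i, F i (tnth t i)] =
  F ord0 `*` [set t | forall i, F (lift ord0 i) (tnth t i)].
Proof.
apply/seteqP; split=> [[x t] /= h|[x t] /= [h0 h] i].
  split; first exact: (h ord0).
  by move=> i; move: (h (lift ord0 i)); rewrite tnthS.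
by case: (unliftP ord0 i) => [j ->|-> //]; rewrite tnthS.
Qed.

Section step.
Variables (k : nat) (la : {sigma_finite_measure set RT -> \bar R}).
Variable mu : {sigma_finite_measure set (k.-tuple RT) -> \bar R}.
Let nu : {measure set (RT * k.-tuple RT)%type -> \bar R} := (la \x mu)%E.
Let nuc := pushforward nu (@tcons k).

Let nuc0 : nuc set0 = 0%E.
Proof. by rewrite /nuc /pushforward preimage_set0 measure0. Qed.

Let nuc_ge0 A : (0 <= nuc A)%E.
Proof. exact: (measure_ge0 nu). Qed.

Let nuc_sigma_additive : semi_sigma_additive nuc.
Proof.
have mc := @measurable_tcons k.
move=> F mF tF mUF; rewrite /nuc /pushforward preimage_bigcup.
apply: measure_semi_sigma_additive.
- by move=> n; rewrite -[X in measurable X]setTI; exact: mc.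
- apply/trivIsetP => /= i j _ _ ij; rewrite -preimage_setI.
  by move/trivIsetP : tF => /(_ _ _ _ _ ij) ->//; rewrite preimage_set0.
- by rewrite -preimage_bigcup -[X in measurable X]setTI; exact: mc.
Qed.

HB.instance Definition _ := isMeasure.Build _ _ _ nuc
  nuc0 nuc_ge0 nuc_sigma_additive.

Let nuc_sigma_finite : sigma_finite setT nuc.
Proof.
have /sigma_finiteP[F1 [T1 nd1 oo1]] := sigma_finiteT la.
have /sigma_finiteP[F2 [T2 nd2 oo2]] := sigma_finiteT mu.
pose F n := F1 n `*` F2 n.
have TF : [set: RT * k.-tuple RT] = \bigcup_n F n.
  rewrite -setXTT T1 T2; apply/seteqP; split=> -[x y] /=.
    move=> [[i _ Fx] [j _ Fy]]; exists (maxn i j) => //; split.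
    - by move: x Fx; exact/subsetPset/nd1/leq_maxl.
    - by move: y Fy; exact/subsetPset/nd2/leq_maxr.
  by move=> [n _ [? ?]]; split; exists n.
have Foo n : measurable (F n) /\ (nu (F n) < +oo)%E.
  have [? ?] := oo1 n; have [? ?] := oo2 n; split; first exact: measurableX.
  by rewrite /nu/= product_measure1E// lte_mul_pinfty// ge0_fin_numE.
pose g (t : k.+1.-tuple RT) : RT * k.-tuple RT :=
  (tnth t ord0, [tuple of behead t]).
have cg : cancel (@tcons k) g.
  move=> [x t]; congr pair => /=.
  by apply: val_inj.
have mg : measurable_fun setT g.
  apply/measurable_fun_pairP; split.
    exact: measurable_tnth.
  exact: measurable_behead.
exists (fun n => g @^-1` F n).
  by rewrite -preimage_bigcup -TF.
move=> n; have [mF Fn] := Foo n; split.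
  by rewrite -[X in measurable X]setTI; exact: mg.
rewrite /nuc /pushforward -comp_preimage (_ : _ \o _ = id) ?preimage_id//.
by apply/funext => p /=; rewrite cg.
Qed.

HB.instance Definition _ :=
  Measure_isSigmaFinite.Build _ _ _ nuc nuc_sigma_finite.

Let stepE : exists mu' : {sigma_finite_measure set (k.+1.-tuple RT) -> \bar R},
  mu' = pushforward (la \x mu)%E (@tcons k)
    :> (set _ -> \bar R).
Proof. by exists nuc. Qed.
Definition lebesgue_tuple_step := stepE.

End step.

Lemma lebesgue_tuple_subproof k :
  exists mu : {sigma_finite_measure set (k.-tuple RT) -> \bar R},
    mu = @lebesgue_tuple k :> (set _ -> \bar R).
Proof.
elim: k => [|k [mu muE]] /=.
  by exists \d_ ([tuple] : 0.-tuple RT).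
by rewrite -muE; exact: (lebesgue_tuple_step lebesgue_measure).
Qed.

Let lebesgue_tuple0 k : @lebesgue_tuple k set0 = 0%E.
Proof. by have [mu <-] := lebesgue_tuple_subproof k. Qed.

Let lebesgue_tuple_ge0 k A : (0 <= @lebesgue_tuple k A)%E.
Proof. by have [mu <-] := lebesgue_tuple_subproof k. Qed.

Let lebesgue_tuple_sigma_additive k : semi_sigma_additive (@lebesgue_tuple k).
Proof.
have [mu <-] := lebesgue_tuple_subproof k.
exact: measure_semi_sigma_additive.
Qed.

HB.instance Definition _ k := isMeasure.Build _ _ _ (@lebesgue_tuple k)
  (lebesgue_tuple0 k) (@lebesgue_tuple_ge0 k) (@lebesgue_tuple_sigma_additive k).

Let lebesgue_tuple_sigma_finite k : sigma_finite setT (@lebesgue_tuple k).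
Proof.
by have [mu <-] := lebesgue_tuple_subproof k; exact: (sigma_finiteT mu).
Qed.

HB.instance Definition _ k := Measure_isSigmaFinite.Build _ _ _
  (@lebesgue_tuple k) (@lebesgue_tuple_sigma_finite k).

Lemma lebesgue_tuple_box k (F : 'I_k -> set RT) :
  (forall i, measurable (F i)) ->
  @lebesgue_tuple k [set t | forall i, F i (tnth t i)] =
  (\prod_(i < k) lebesgue_measure (F i))%E.
Proof.
elim: k F => [|k IH] F mF.
  rewrite big_ord0 /= diracE mem_set//=.
  by case.
rewrite big_ord_recl -IH// /= /pushforward tcons_box.
have mF' := @measurable_tuple_box k (fun i => F (lift ord0 i))
  (fun i => mF (lift ord0 i)).
by rewrite (product_measure1E lebesgue_measure (@lebesgue_tuple k)).
Qed.

End lebesgue_tuple.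
Arguments lebesgue_tuple : clear implicits.


(** The matrix whose entries, in the order of [mxvec], are those of [t]. *)
Definition mx_of_tuple (R : realType) m n
    (t : (m * n).-tuple (measurableTypeR R)) : 'M[R]_(m, n) :=
  \matrix_(i, j) tnth t (mxvec_index i j).

(** "For almost every real m x n matrix", with R^(m x n) identified with
    R^(m * n) through [mx_of_tuple]. *)
Definition ae_matrix (R : realType) m n (P : 'M[R]_(m, n) -> Prop) : Prop :=
  {ae lebesgue_tuple R (m * n), forall t, P (mx_of_tuple t)}.

Definition congruence_class d (N : nat) (C : set 'cV[int]_d) : Prop :=
  exists r : 'cV[int]_d, C = [set r + v *+ N | v in [set: 'cV[int]_d]].

(** Real functions on the positive half-line are represented by functions
    [R -> R] of which only the values at positive arguments matter; monotonicity is
    understood in the non-strict sense. *)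
Definition positive_on_pos (R : realType) (g : R -> R) : Prop :=
  forall x, 0 < x -> 0 < g x.

Definition increasing_on_pos (R : realType) (g : R -> R) : Prop :=
  forall x y, 0 < x -> x <= y -> g x <= g y.

Definition decreasing_on_pos (R : realType) (g : R -> R) : Prop :=
  forall x y, 0 < x -> x <= y -> g y <= g x.

Definition polynomial_growth (R : realType) (g : R -> R) : Prop :=
  exists2 k : R, 0 < k & \forall x \near +oo, g x < x `^ k.

(** The library norm on matrices, hence on column vectors, is the sup norm
    ([mx_normrE]). *)
Definition sol_system (R : realType) m n (B : 'M[R]_(m, n)) (N : nat) (Q : R)
    (phi : R -> R) (p : 'cV[int]_m) (q : 'cV[int]_n) : Prop :=
  `|B *m map_mx intr q - map_mx intr p| ^+ m < N%:R ^+ m * phi Q /\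
  `|map_mx intr q : 'cV[R]_n| ^+ n < (N%:R / 2) ^+ n * Q.

Definition solvable_in (R : realType) m n (B : 'M[R]_(m, n)) (N : nat) (Q : R)
    (phi : R -> R) (C : set 'cV[int]_(m + n)) : Prop :=
  exists p q, C (col_mx p q) /\ sol_system B N Q phi p q.

(* Main.v *)
Require Import Defs.
From mathcomp Require Import all_boot all_order all_algebra.
From mathcomp Require Import all_classical all_reals all_analysis.
From mathcomp Require Import measurable_realfun ring lra.

Import Order.TTheory GRing.Theory Num.Theory.
Import numFieldNormedType.Exports.

Local Open Scope classical_set_scope.
Local Open Scope ring_scope.

(** Dividing by [N], a solution in the class of [r] modulo [N] is an integer
    point [z] for which [e = r / N - z] satisfies [|B e_q - e_p| < X] and
    [|e_q| < Y], where [X ^ m = phi Q] and [(2 Y) ^ n = Q]: a translate of a box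
    by a rational point must meet a lattice of covolume one.

    Solvability.  By transference ([transference], applied to the system in
    [transference_system]) every translate of the box, rational or not, meets
    the lattice unless the dual lattice has a short vector: integer rows [u], [v],
    not both zero, with [X |u|] and [Y |u B + v|] bounded by a constant depending
    on [m + n] only; [N] has disappeared.  For large [Q] such a [u] is nonzero.
    There are about [X ^- m] candidates [u], and for each of them the set of [B],
    in a bounded region, such that [u B] is within [1 / Y] of an integer row has
    measure of order [Y ^- n] ([lebesgue_slab_le]).  At the scale [Q = e ^ k] the
    total measure is thus of order [X ^- m * Y ^- n], at most a constant times
    [1 / f k], which is summable; the Borel-Cantelli lemma, in the form of the
    convergence part of the Khintchine-Groshev theorem ([groshev_convergence]),
    leaves for almost every [B] only finitely many scales with a short dual
    vector.

    Unsolvability.  Here the box has volume [2 ^ m * X ^ m * Q], at most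
    [2 ^ m * f (ln Q) ^ (- 1 / m)].  A summable [1 / f] with [f] increasing forces
    [f] to be unbounded, so the volume is less than one for large [Q], and then
    the dilated box contains fewer than [N ^ (m + n)] integer points once [N] is
    large ([card_classes_le], [unsolvable_class]): some class is missed, and this
    for every [B]. *)

(** * Transference between a lattice and its dual *)

Section transference.
Context {R : realType}.

Definition sqn e (v : 'rV[R]_e) : R := \sum_j v 0 j ^+ 2.

Lemma sqn_ge0 e (v : 'rV[R]_e) : 0 <= sqn e v.
Proof. by apply: sumr_ge0 => j _; exact: sqr_ge0. Qed.

Lemma sqnE e (v : 'rV[R]_e) : sqn e v = (v *m v^T) 0 0.
Proof. by rewrite mxE; apply: eq_bigr => j _; rewrite mxE expr2. Qed.

Lemma sqn_orthogonal e (t : R) (s v : 'rV[R]_e) : v *m s^T = 0 ->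
  sqn e (t *: s + v) = t ^+ 2 * sqn e s + sqn e v.
Proof.
move=> vs.
have sv : s *m v^T = 0 by rewrite -[s]trmxK -trmx_mul vs trmx0.
rewrite !sqnE linearD linearZ /= !mulmxDl !mulmxDr -!scalemxAl -!scalemxAr vs sv.
by rewrite !mxE; ring.
Qed.

Lemma nearest_int (x : R) : exists z : int, `|x - z%:~R| <= 2^-1.
Proof.
exists (Num.floor (x + 2^-1)); rewrite ler_norml.
have := floor_le (x + 2^-1); have := floorD1_gt (x + 2^-1).
by rewrite intrD; lra.
Qed.

Lemma sqr_le_quarter (x : R) : `|x| <= 2^-1 -> x ^+ 2 <= 4^-1.
Proof. by rewrite ler_norml => /andP[? ?]; nra. Qed.

(** The infimum of the squared length over nonzero integer rows is positive, so a
    row within a factor two of it exists without any discreteness argument. *)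
Lemma near_minimum_sqn d e (S : 'M[R]_(d.+1, e)) (rho : R) : 0 < rho ->
  (forall w : 'rV[int]_d.+1, w != 0 -> rho <= sqn e (map_mx intr w *m S)) ->
  exists2 w0 : 'rV[int]_d.+1, w0 != 0 &
   forall w : 'rV[int]_d.+1, w != 0 ->
   sqn e (map_mx intr w0 *m S) <= 2 * sqn e (map_mx intr w *m S).
Proof.
move=> rho0 hS.
pose E := [set sqn e (map_mx intr w *m S) | w in [set w : 'rV[int]_d.+1 | w != 0]].
have lbE : lbound E rho by move=> _ [w w0 <-]; exact: hS.
have E0 : E !=set0.
  exists (sqn e (map_mx intr (const_mx 1 : 'rV[int]_d.+1) *m S)).
  exists (const_mx 1) => //=; apply/eqP => /matrixP /(_ 0 0).
  by rewrite !mxE.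
have hE : has_inf E by split => //; exists rho.
have infge : rho <= inf E by exact: lb_le_inf.
have i0 : 0 < inf E by exact: lt_le_trans infge.
have [_ [w0 w00 <-] hw0] := inf_adherent i0 hE.
exists w0 => // w w_neq0; apply: (le_trans (ltW hw0)).
have : inf E <= sqn e (map_mx intr w *m S).
  by apply: ge_inf; [exact: hE.2 | exists w].
lra.
Qed.

(** Smith normal form of a one-row matrix. *)
Lemma row_of_unimodular d (w : 'rV[int]_d.+1) : w != 0 ->
  exists (U : 'M[int]_d.+1) (k : int), [/\ U \in unitmx, k != 0 & w = k *: row 0 U].
Proof.
move=> w0; have [L _ [U Uu [D _ wE]]] := int_Smith_normal_form w.
exists U, (L 0 0 * D`_0).
have {}wE : w = (L 0 0 * D`_0) *: row 0 U.
  rewrite {1}wE; apply/rowP => j; rewrite !mxE (bigD1 0) //= big1 ?addr0; last first.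
    move=> i i0; rewrite !mxE big_ord_recl big_ord0 !mxE /=.
    by rewrite eq_sym (negbTE i0 : (i == 0 :> nat) = false) mulr0n mulr0 addr0 mul0r.
  by rewrite !mxE big_ord_recl big_ord0 !mxE /= mulr1n addr0.
split=> //; apply: contra_neq w0 => k0; by rewrite wE k0 scale0r.
Qed.

(** Dividing a near-shortest row by its content only shortens it, so it can be
    taken primitive, that is, completed to a basis of the integer lattice. *)
Lemma near_minimum_unimodular d e (S : 'M[R]_(d.+1, e)) (rho : R) : 0 < rho ->
  (forall w : 'rV[int]_d.+1, w != 0 -> rho <= sqn e (map_mx intr w *m S)) ->
  exists2 U : 'M[int]_d.+1, U \in unitmx &
   forall w : 'rV[int]_d.+1, w != 0 ->
   sqn e (row 0 (map_mx intr U *m S)) <= 2 * sqn e (map_mx intr w *m S).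
Proof.
move=> rho0 hS; have [w0 w00 hw0] := near_minimum_sqn d e S rho rho0 hS.
have [U [k [Uu k0 w0E]]] := row_of_unimodular d w0 w00.
exists U => // w wn; apply: le_trans (hw0 w wn).
rewrite w0E map_mxZ -scalemxAl row_mul map_row.
rewrite /sqn; apply: ler_sum => j _.
rewrite [leRHS]expr2 !mxE mulrACA -!expr2 ler_peMl ?sqr_ge0//.
by rewrite -rmorphXn /= ler1z -gtz0_ge1 exprn_even_gt0.
Qed.

(** The Cauchy-Schwarz inequality for [t * e + r = (t * sqrt a) * (e / sqrt a) + r],
    in a form without square roots. *)
Lemma cauchy_schwarz2 (t e r a A K H : R) : 0 < a -> 0 <= K -> 0 <= H ->
  e ^+ 2 <= a * A -> r ^+ 2 <= K * H -> 0 <= A ->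
  (t * e + r) ^+ 2 <= (A + K) * (t ^+ 2 * a + H).
Proof.
move=> a0 K0 H0 he hr A0.
have hte : (t * e) ^+ 2 <= (t ^+ 2 * a) * A.
  by rewrite exprMn -mulrA ler_wpM2l ?sqr_ge0.
set P := t * e in hte *; set G := t ^+ 2 * a in hte *.
have G0 : 0 <= G by rewrite mulr_ge0 ?sqr_ge0 ?ltW.
(* so that mulr_ge0 does not decompose the products P and G *)
clearbody P G.
(* the cross term, by the inequality of arithmetic and geometric means *)
have h2 : 2 * (P * r) <= A * H + K * G.
  apply: le_trans (ler_norm _) _.
  have b0 : 0 <= A * H + K * G by rewrite addr_ge0 ?mulr_ge0.
  rewrite -(ler_pXn2r (n := 2)) ?nnegrE ?normr_ge0//.
  rewrite real_normK ?num_real//.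
  have h1 : (P * r) ^+ 2 <= (G * A) * (K * H).
    by rewrite exprMn ler_pM ?sqr_ge0.
  rewrite (_ : (A * H + K * G) ^+ 2 =
    (A * H - K * G) ^+ 2 + 4 * ((G * A) * (K * H))); last by ring.
  rewrite (_ : (2 * (P * r)) ^+ 2 = 4 * (P * r) ^+ 2); last by ring.
  have : 0 <= (A * H - K * G) ^+ 2 by exact: sqr_ge0.
  by lra.
rewrite (_ : (P + r) ^+ 2 = P ^+ 2 + 2 * (P * r) + r ^+ 2); last by ring.
rewrite (_ : (A + K) * (G + H) = G * A + (A * H + K * G) + K * H); last by ring.
by rewrite !lerD.
Qed.

(** Pythagoras: the rows of [S] after the first are projected orthogonally to the
    first one, [l] holding the coefficients of the subtracted multiples. *)
Lemma sqn_projection d e (S : 'M[R]_(1 + d, e)) (y : 'rV[R]_(1 + d))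
    (l := (sqn e (usubmx S))^-1 *: (dsubmx S *m (usubmx S)^T)) :
  sqn e (usubmx S) != 0 ->
  sqn e (y *m S) =
    ((lsubmx y + rsubmx y *m l) 0 0) ^+ 2 * sqn e (usubmx S)
    + sqn e (rsubmx y *m (dsubmx S - l *m usubmx S)).
Proof.
move=> a0; rewrite -sqn_orthogonal; last first.
  rewrite -mulmxA mulmxBl -mulmxA [usubmx S *m _]mx11_scalar -sqnE.
  by rewrite mul_mx_scalar scalerA divff// scale1r subrr mulmx0.
congr (sqn e _).
rewrite -mul_scalar_mx -mx11_scalar mulmxDl mulmxBr mulmxA.
rewrite -addrA (addrC (_ *m l *m _)) subrK.
by rewrite -{1}(vsubmxK S) -{1}(hsubmxK y) mul_row_col.
Qed.

(** If the lattice spanned by the rows of [S] has no short vector, then the dual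
    lattice has a small covering radius.  The dual norm of [x - z] is written as a
    bound on all the values [y *m (x - z)], so that neither inverses nor
    orthonormal bases occur, and [S] need not be square.

    Induction on [d], as for a Korkine-Zolotarev reduced basis.  After a unimodular
    change of basis the first row [s] of the lattice basis has squared length [a]
    at most twice the minimum.  The projection of the other rows orthogonally to
    [s] spans a lattice whose squared minimum is at least [rho / 2]: a short vector
    of it would lift, adding a multiple of [s] with coefficient at most [1/2], to a
    vector shorter than the minimum.  One rounds the first coordinate of [x],
    which costs at most [1 / (4 a)], and handles the others by induction; the
    constants obey [2 * 3 ^ d + 1/4 <= 3 ^ (d + 1)]. *)
Lemma transference d e (S : 'M[R]_(d, e)) (rho : R) : 0 < rho ->
  (forall w : 'rV[int]_d, w != 0 -> rho <= sqn e (map_mx intr w *m S)) ->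
  forall x : 'cV[R]_d, exists z : 'cV[int]_d, forall y : 'rV[R]_d,
    ((y *m (x - map_mx intr z)) 0 0) ^+ 2 <= 3 ^+ d / rho * sqn e (y *m S).
Proof.
elim: d S rho => [|d IHd] S rho rho0 hS x.
  exists 0 => y; rewrite (_ : y *m _ = 0); last by rewrite (flatmx0 (x - _)) mulmx0.
  by rewrite mxE expr0n /= mulr_ge0 ?sqn_ge0// expr0 div1r invr_ge0 ltW.
have [U Uu hU] := near_minimum_unimodular d e S rho rho0 hS.
pose UR : 'M[R]_d.+1 := map_mx intr U.
pose V : 'M[R]_(1 + d, e) := UR *m S.
have URu : UR \in unitmx by rewrite unitmxE det_map_mx rmorph_unit// -unitmxE.
have sE : usubmx V = row 0 V.
  by apply/rowP => j; rewrite [LHS]mxE [RHS]mxE; congr (V _ _); apply/val_inj.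
pose a := sqn e (usubmx V).
have hw (w : 'rV[int]_(1 + d)) : w != 0 ->
    rho <= sqn e (map_mx intr w *m V) /\ a <= 2 * sqn e (map_mx intr w *m V).
  move=> w0; rewrite /V mulmxA -map_mxM.
  have wU0 : w *m U != 0.
    by apply: contra_neq w0 => wU; rewrite -[w](mulmxK Uu) wU mul0mx.
  by rewrite /a sE; split; [exact: hS | exact: hU].
have arho : rho <= a.
  have w1 : row_mx 1%:M 0 != 0 :> 'rV[int]_(1 + d).
    apply/eqP => /(congr1 lsubmx); rewrite row_mxKl => /matrixP/(_ 0 0).
    by rewrite !mxE.
  have [+ _] := hw _ w1; rewrite map_row_mx map_scalar_mx map_mx0 /=.
  rewrite -{1}[V]vsubmxK mul_row_col mul0mx addr0 mul1mx; exact.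
have a0 : 0 < a by exact: lt_le_trans arho.
pose l := a^-1 *: (dsubmx V *m (usubmx V)^T).
pose T := dsubmx V - l *m usubmx V.
have split_sqn y : sqn e (y *m V) =
    ((lsubmx y + rsubmx y *m l) 0 0) ^+ 2 * a + sqn e (rsubmx y *m T).
  by apply: sqn_projection; rewrite gt_eqF.
have rho2 : 0 < rho / 2 by lra.
(* the projected lattice has no short vector: lift w with |coefficient| <= 1/2 *)
have hT (w : 'rV[int]_d) : w != 0 -> rho / 2 <= sqn e (map_mx intr w *m T).
  move=> w0; have [z hz] := nearest_int (- ((map_mx intr w *m l) 0 0)).
  have wz0 : row_mx z%:M w != 0 :> 'rV[int]_(1 + d).
    apply: contra_neq w0 => /(congr1 rsubmx); rewrite row_mxKr => ->.
    by apply/rowP => j; rewrite !mxE.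
  have [h1 h2] := hw _ wz0; move: h1 h2.
  rewrite split_sqn map_row_mx row_mxKl row_mxKr map_scalar_mx /=.
  rewrite mxE [(z%:~R)%:M 0 0]mxE eqxx mulr1n.
  set q := (_ *m l) 0 0 in hz *; set H := sqn _ _.
  have : (z%:~R + q) ^+ 2 <= 4^-1.
    by apply: sqr_le_quarter; rewrite -normrN opprD addrC.
  set Z := (z%:~R + q) ^+ 2 => hZ h1 h2.
  have : Z * a <= 4^-1 * a by rewrite ler_wpM2r ?(ltW a0).
  lra.
(* coordinates of the target in the new basis; the first one is rounded, which
   shifts the others along l *)
pose xt : 'cV[R]_(1 + d) := UR *m x.
have [z1 hz1] := nearest_int ((usubmx xt) 0 0).
pose e1 := (usubmx xt) 0 0 - z1%:~R.
have [z' hz'] := IHd T _ rho2 hT (dsubmx xt - e1 *: l).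
pose zt : 'cV[int]_(1 + d) := col_mx z1%:M z'.
have ztE : map_mx intr zt = col_mx z1%:~R%:M (map_mx intr z') :> 'cV[R]_(1 + d).
  by rewrite map_col_mx map_scalar_mx.
exists (invmx U *m zt) => y.
have UinvE : map_mx intr (invmx U) = invmx UR
  by rewrite -[LHS](mulKmx URu) -map_mxM mulmxV// map_mx1 mulmx1.
pose yt : 'rV[R]_(1 + d) := y *m invmx UR.
have -> : y *m S = yt *m V by rewrite /yt /V !mulmxA mulmxKV.
have -> : y *m (x - map_mx intr (invmx U *m zt)) =
    yt *m (xt - col_mx z1%:~R%:M (map_mx intr z')).
  rewrite map_mxM UinvE ztE !mulmxBr /yt /xt !mulmxA mulmxKV//.
have -> : (yt *m (xt - col_mx z1%:~R%:M (map_mx intr z'))) 0 0 =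
    ((lsubmx yt + rsubmx yt *m l) 0 0) * e1 +
    (rsubmx yt *m (dsubmx xt - e1 *: l - map_mx intr z')) 0 0.
  have -> : xt - col_mx z1%:~R%:M (map_mx intr z') =
     col_mx e1%:M (dsubmx xt - map_mx intr z').
    rewrite -{1}[xt]vsubmxK opp_col_mx add_col_mx; congr col_mx.
    by rewrite [usubmx xt]mx11_scalar -raddfB.
  rewrite -{1}[yt]hsubmxK mul_row_col mul_mx_scalar.
  rewrite (addrAC (dsubmx xt)) (mulmxBr _ (dsubmx xt - _)) -(scalemxAr e1 _ l).
  move: (rsubmx yt *m (dsubmx xt - _)) (rsubmx yt *m l) (lsubmx yt) => M1 M2 M3.
  by rewrite !mxE; ring.
rewrite split_sqn.
have he1 : e1 ^+ 2 <= 4^-1 by exact: sqr_le_quarter.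
have := cauchy_schwarz2 _ _ _ a (a^-1 * 4^-1) _ _ a0 _ _ _ (hz' (rsubmx yt)) _.
move=> /(_ ((lsubmx yt + rsubmx yt *m l) 0 0) e1); rewrite mulrA mulfV ?gt_eqF// mul1r.
have K0 : 0 <= 3 ^+ d / (rho / 2) :> R by rewrite divr_ge0 ?exprn_ge0// ltW.
move=> /(_ K0 (sqn_ge0 _ _) he1).
move=> /(_ _)/le_trans; apply.
  by rewrite mulr_ge0// invr_ge0 ltW.
apply: ler_wpM2r.
  by rewrite addr_ge0 ?sqn_ge0// mulr_ge0 ?sqr_ge0 ?ltW.
have ia : a^-1 <= rho^-1 by rewrite lef_pV2 ?posrE.
rewrite exprS invfM invrK.
have : 1 <= 3 ^+ d :> R by rewrite exprn_ege1// ler1n.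
have : 0 < rho^-1 by rewrite invr_gt0.
move: (3 ^+ d) => c r0 c1.
nra.
Qed.

End transference.

(** * Solving the system in the absence of short dual vectors *)

Lemma mx_norm_ltP (R : realType) m n (M : 'M[R]_(m, n)) (c : R) : 0 < c ->
  `|M| < c <-> forall i j, `|M i j| < c.
Proof.
move=> c0; rewrite /Num.norm /= mx_normrE; split => [/bigmax_ltP[_ h] i j|h].
  exact: (h (i, j)).
by apply/bigmax_ltP; split => // -[i j] _; exact: h.
Qed.

Section inhomogeneous.
Context {R : realType}.

Lemma sqn_row_mx e1 e2 (u : 'rV[R]_e1) (v : 'rV[R]_e2) :
  sqn (e1 + e2) (row_mx u v) = sqn e1 u + sqn e2 v.
Proof.
rewrite /sqn big_split_ord /=; congr (_ + _); apply: eq_bigr => j _.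
  by rewrite row_mxEl.
by rewrite row_mxEr.
Qed.

Lemma sqnZ e (a : R) (v : 'rV[R]_e) : sqn e (a *: v) = a ^+ 2 * sqn e v.
Proof. by rewrite /sqn mulr_sumr; apply: eq_bigr => j _; rewrite !mxE exprMn. Qed.

Lemma sqr_entry_le_sqn e (v : 'rV[R]_e) j : v 0 j ^+ 2 <= sqn e v.
Proof. by rewrite /sqn (bigD1 j)//= lerDl sumr_ge0// => i _; rewrite sqr_ge0. Qed.

Lemma sqn0 e : sqn e (0 : 'rV[R]_e) = 0.
Proof. by rewrite /sqn big1// => j _; rewrite mxE expr0n. Qed.

Lemma sqn_delta e j : sqn e (delta_mx 0 j : 'rV[R]_e) = 1.
Proof.
rewrite /sqn (bigD1 j)//= big1 => [|i ij]; first by rewrite mxE !eqxx addr0 expr1n.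
by rewrite mxE (negbTE ij) andbF expr0n.
Qed.

(** The rows [(u, v)] are given the length of [(X * u, Y * (u *m B + v))].  In the
    conclusion of the transference theorem, [y = (- delta_i, delta_i *m B)], of
    length [X], reads off a coordinate of [B e_q - e_p], and [y = (0, delta_j)], of
    length [Y], a coordinate of [e_q].  With [T = 1 + 3 ^ (m + n)] the factor
    [3 ^ (m + n) / T ^ 2] is less than one, whence the strict inequalities. *)
Lemma transference_system m n (B : 'M[R]_(m, n)) (X Y : R)
    (T := 1 + 3 ^+ (m + n)) : 0 < X -> 0 < Y ->
  (forall (u : 'rV[int]_m) (v : 'rV[int]_n),
    (forall i, X * `|(u 0 i)%:~R| < T) ->
    (forall j, Y * `|(map_mx intr u *m B + map_mx intr v) 0 j| < T) ->
    u = 0 /\ v = 0) ->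
  forall x : 'cV[R]_(m + n), exists z : 'cV[int]_(m + n),
    let e := x - map_mx intr z in
    (forall i, `|(B *m dsubmx e - usubmx e) i 0| < X) /\
    (forall j, `|dsubmx e j 0| < Y).
Proof.
move=> X0 Y0 hB x.
have T1 : 1 <= T by rewrite /T lerDl exprn_ge0.
have T0 : 0 < T by exact: lt_le_trans T1.
have [TR XR YR] : [/\ 0 <= T, 0 <= X & 0 <= Y] by split; exact: ltW.
pose S : 'M[R]_(m + n) := block_mx X%:M (Y *: B) 0 Y%:M.
have sqnS (u : 'rV[R]_m) (v : 'rV[R]_n) : sqn (m + n) (row_mx u v *m S) =
    X ^+ 2 * sqn m u + Y ^+ 2 * sqn n (u *m B + v).
  rewrite /S mul_row_block mulmx0 addr0 !mul_mx_scalar -scalemxAr -scalerDr.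
  by rewrite sqn_row_mx !sqnZ.
have hS (w : 'rV[int]_(m + n)) : w != 0 ->
    T ^+ 2 <= sqn (m + n) (map_mx intr w *m S).
  apply: contra_neqT; rewrite -ltNge -[w]hsubmxK map_row_mx sqnS => lt.
  have [] := hB (lsubmx w) (rsubmx w).
  - move=> i; rewrite -(@ltr_pXn2r _ 2)// ?nnegrE ?mulr_ge0 ?normr_ge0//.
    apply: le_lt_trans lt; rewrite exprMn real_normK ?num_real//.
    rewrite -[leLHS]addr0 lerD ?mulr_ge0 ?sqr_ge0 ?sqn_ge0//.
    rewrite ler_wpM2l ?sqr_ge0//.
    by apply: le_trans (sqr_entry_le_sqn _ _ i); rewrite !mxE.
  - move=> i; rewrite -(@ltr_pXn2r _ 2)// ?nnegrE ?mulr_ge0 ?normr_ge0//.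
    apply: le_lt_trans lt; rewrite exprMn real_normK ?num_real//.
    rewrite -[leLHS]add0r lerD ?mulr_ge0 ?sqr_ge0 ?sqn_ge0//.
    by rewrite ler_wpM2l ?sqr_ge0//; exact: sqr_entry_le_sqn.
  by move=> -> ->; rewrite row_mx0.
have [z hz] := transference _ _ S (T ^+ 2) (exprn_gt0 _ T0) hS x.
exists z => e.
have c1 : 3 ^+ (m + n) / T ^+ 2 < 1.
  rewrite ltr_pdivrMr ?exprn_gt0// mul1r expr2.
  apply: lt_le_trans (ler_peMl (ltW T0) T1).
  by rewrite /T ltrDr.
have hz' (u : 'rV[R]_m) (v : 'rV[R]_n) (W : R) : 0 < W ->
    X ^+ 2 * sqn m u + Y ^+ 2 * sqn n (u *m B + v) = W ^+ 2 ->
    `|(u *m usubmx e + v *m dsubmx e) 0 0| < W.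
  move=> W0 hW; rewrite -(@ltr_pXn2r _ 2)// ?nnegrE ?ltW//.
  rewrite real_normK ?num_real// -mul_row_col vsubmxK.
  apply: le_lt_trans (hz _) _; rewrite sqnS hW gtr_pMl// exprn_gt0//.
split.
- move=> i; have := hz' (- delta_mx 0 i) (delta_mx 0 i *m B) X X0.
  rewrite mulNmx addNr sqn0 mulr0 addr0 -scaleN1r sqnZ sqn_delta sqrrN expr1n !mulr1.
  move=> /(_ erefl).
  by rewrite scaleN1r mulNmx -mulmxA addrC -mulmxBr -rowE mxE.
- move=> j; have := hz' 0 (delta_mx 0 j) Y Y0.
  rewrite !mul0mx sqn0 mulr0 !add0r sqn_delta mulr1 => /(_ erefl).
  by rewrite -rowE mxE.
Qed.

(** The target is [r / N] for a representative [r] of the congruence class, and the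
    solution is [N] times the error [r / N - z]. *)
Lemma solvable_of_no_small_dual m n (B : 'M[R]_(m, n)) (Q X Y : R) (phi : R -> R)
    (T := 1 + 3 ^+ (m + n)) : 0 < X -> 0 < Y ->
  X ^+ m = phi Q -> (2 * Y) ^+ n = Q ->
  (forall (u : 'rV[int]_m) (v : 'rV[int]_n),
    (forall i, X * `|(u 0 i)%:~R| < T) ->
    (forall j, Y * `|(map_mx intr u *m B + map_mx intr v) 0 j| < T) ->
    u = 0 /\ v = 0) ->
  (0 < m)%N -> (0 < n)%N ->
  forall (N : nat) (C : set 'cV[int]_(m + n)), (0 < N)%N -> congruence_class N C ->
  solvable_in B N Q phi C.
Proof.
move=> X0 Y0 XQ YQ hB m0 n0 N C N0 [r ->].
have NR : 0 < N%:R :> R by rewrite ltr0n.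
have [z [hp hq]] := transference_system m n B X Y X0 Y0 hB (N%:R^-1 *: map_mx intr r).
pose s := r - z *+ N.
have sE : map_mx intr s = N%:R *: (N%:R^-1 *: map_mx intr r - map_mx intr z) :> 'cV[R]_(m + n).
  rewrite scalerBr scalerA divff ?gt_eqF// scale1r scaler_nat /s.
  by rewrite map_mxB raddfMn.
exists (usubmx s), (dsubmx s); split.
  by rewrite vsubmxK /s /=; exists (- z) => //; rewrite mulNrn.
move: hp hq; set e := _ - _ in sE * => hp hq.
have uE : map_mx intr (usubmx s) = N%:R *: usubmx e.
  by rewrite map_usubmx sE; apply/matrixP => i j; rewrite !mxE.
have dE : map_mx intr (dsubmx s) = N%:R *: dsubmx e.
  by rewrite map_dsubmx sE; apply/matrixP => i j; rewrite !mxE.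
split.
- rewrite -XQ -exprMn ltr_pXn2r ?nnegrE ?mulr_ge0 ?ler0n ?(ltW X0)// -?lt0n//.
  apply/mx_norm_ltP; first exact: mulr_gt0.
  move=> i j; rewrite uE dE -scalemxAr -scalerBr mxE normrM ger0_norm ?ler0n//.
  by rewrite ltr_pM2l// ord1.
- rewrite -YQ -exprMn ltr_pXn2r ?nnegrE ?mulr_ge0 ?ler0n ?invr_ge0 ?(ltW Y0)// -?lt0n//.
  have -> : N%:R / 2 * (2 * Y) = N%:R * Y by field.
  apply/mx_norm_ltP; first exact: mulr_gt0.
  move=> i j; rewrite dE mxE normrM ger0_norm ?ler0n//.
  by rewrite ltr_pM2l// ord1.
Qed.

End inhomogeneous.

(** * Counting: boxes of volume less than one *)

Section counting.
Context {R : realType}.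

(** The rank of [z] among the integers greater than [lo]; an open interval of
    length [L] holds at most [truncn L + 1] of them, so that for those in
    [(lo, lo + L)] the truncation in [inord] has no effect. *)
Definition rank_in (lo L : R) (z : int) : 'I_(Num.truncn L).+1 :=
  inord (absz (z - Num.floor lo - 1)%R).

Lemma rank_in_inj (lo L : R) (z z' : int) :
  lo < z%:~R < lo + L -> lo < z'%:~R < lo + L ->
  rank_in lo L z = rank_in lo L z' -> z = z'.
Proof.
have aux (t : int) : lo < t%:~R < lo + L ->
    exists2 k : 'I_(Num.truncn L).+1, t = k%:Z + Num.floor lo + 1 & rank_in lo L t = k.
  move=> /andP[lot tlo].
  have ft : Num.floor lo + 1 <= t.
    by rewrite lezD1 floor_lt_int.
  have k0 : 0 <= t - Num.floor lo - 1 by rewrite -addrA -opprD subr_ge0.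
  have kE : (absz (t - Num.floor lo - 1)%R : int) = t - Num.floor lo - 1.
    by rewrite gez0_abs.
  have kL : (absz (t - Num.floor lo - 1)%R < (Num.truncn L).+1)%N.
    rewrite ltnS truncn_ge_nat; last first.
      by have := lt_trans lot tlo; lra.
    rewrite (_ : _%:R = (t - Num.floor lo - 1)%:~R); last by rewrite -kE.
    have := floorD1_gt lo; rewrite !intrD !rmorphN /=; lra.
  exists (Ordinal kL) => /=; first by rewrite kE; ring.
  by apply/val_inj; rewrite /rank_in /= inordK.
move=> /aux[k -> ->] /aux[k' -> ->] kk.
by rewrite kk.
Qed.

(** Solutions in distinct classes are distinct, and a solution is determined by the
    ranks of its coordinates: those of [q] lie in a fixed interval of length
    [N * Y], and, given [q], those of [p] in intervals of length [2 * N * X]. *)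
Lemma card_classes_le m n (B : 'M[R]_(m, n)) (N : nat) (X Y : R)
    (Q : R) (phi : R -> R) : (0 < m)%N -> (0 < n)%N -> (0 < N)%N ->
  0 < X -> 0 < Y -> phi Q <= X ^+ m -> Q = Y ^+ n ->
  (forall C : set 'cV[int]_(m + n), congruence_class N C ->
    solvable_in B N Q phi C) ->
  (N ^ (m + n) <=
    (Num.truncn (2 * N%:R * X)).+1 ^ m * (Num.truncn (N%:R * Y)).+1 ^ n)%N.
Proof.
move=> m0 n0 N0 X0 Y0 phiX QY solv.
have NR : 0 < N%:R :> R by rewrite ltr0n.
pose rep (r : {ffun 'I_(m + n) -> 'I_N}) : 'cV[int]_(m + n) := \col_i (r i)%:Z.
have /choice[s hs] : forall r : {ffun 'I_(m + n) -> 'I_N}, exists s : 'cV[int]_(m + n),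
   (exists v, s = rep r + v *+ N) /\
   (forall i, `|(B *m map_mx intr (dsubmx s) - map_mx intr (usubmx s)) i 0| <
      N%:R * X) /\
   (forall j, `|(map_mx intr (dsubmx s) : 'cV[R]_n) j 0| < N%:R / 2 * Y).
  move=> r; have [p [q [[v _ vE] [hp hq]]]] := solv _ (ex_intro _ (rep r) erefl).
  exists (col_mx p q); rewrite col_mxKu col_mxKd; split; first by exists v.
  split=> i.
    have /mx_norm_ltP : `|B *m map_mx intr q - map_mx intr p| < N%:R * X.
      rewrite -(@ltr_pXn2r _ m)// ?nnegrE ?mulr_ge0 ?normr_ge0 ?(ltW X0)//.
      by apply: lt_le_trans hp _; rewrite exprMn ler_pM2l// exprn_gt0.
    by apply; exact: mulr_gt0.
  have /mx_norm_ltP : `|map_mx intr q : 'cV[R]_n| < N%:R / 2 * Y.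
    rewrite -(@ltr_pXn2r _ n)// ?nnegrE ?mulr_ge0 ?invr_ge0 ?normr_ge0 ?(ltW Y0)//.
    by rewrite exprMn -QY.
  by apply; rewrite mulr_gt0// divr_gt0.
pose code (s : 'cV[int]_(m + n)) :=
  ([ffun i => rank_in ((B *m map_mx intr (dsubmx s)) i 0 - N%:R * X) (2 * N%:R * X)
     (usubmx s i 0)] : {ffun 'I_m -> _},
   [ffun j => rank_in (- (N%:R / 2 * Y)) (N%:R * Y) (dsubmx s j 0)] : {ffun 'I_n -> _}).
have code_inj : injective (code \o s).
  move=> r r' /= [/ffunP cu /ffunP cd].
  have [[v vE] [hu hd]] := hs r; have [[v' vE'] [hu' hd']] := hs r'.
  have dE : dsubmx (s r) = dsubmx (s r').
    apply/colP => j; have := cd j; rewrite !ffunE; apply: rank_in_inj.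
      by have := hd j; rewrite mxE ltr_norml; lra.
    by have := hd' j; rewrite mxE ltr_norml; lra.
  have uE : usubmx (s r) = usubmx (s r').
    apply/colP => j; have := cu j; rewrite !ffunE dE; apply: rank_in_inj.
      have := hu j; rewrite dE 2!mxE [X in _ + X]mxE [X in _ - X]mxE ltr_norml.
      rewrite [X in X -> _]/=; lra.
    have := hu' j; rewrite 2!mxE [X in _ + X]mxE [X in _ - X]mxE ltr_norml; lra.
  have : s r = s r' by rewrite -[s r]vsubmxK uE dE vsubmxK.
  rewrite vE vE' => /colP E; apply/ffunP => i; apply/val_inj.
  have valE (t : {ffun 'I_(m + n) -> 'I_N}) (u : 'cV[int]_(m + n)) :
      modz ((rep t + u *+ N) i 0) N = t i.
    rewrite mxE mulmxnE mxE -(mulr_natr (u i 0)) natz addrC modzMDl modz_small//.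
    by rewrite ltz_nat ltn_ord.
  by have := congr1 (modz^~ N) (E i); rewrite !valE => -[].
have := leq_card _ code_inj.
by rewrite card_prod !card_ffun !card_ord.
Qed.

(** If the box has volume less than one, the rounding errors in the count of
    integer points, of relative size [1 / N], are harmless for large [N]. *)
Lemma unsolvable_class m n (B : 'M[R]_(m, n)) (X Y Q : R) :
  (0 < m)%N -> (0 < n)%N -> 0 < X -> 0 < Y -> Q = Y ^+ n ->
  (2 * X) ^+ m * Y ^+ n < 1 ->
  exists N0 : nat, forall N : nat, (0 < N)%N -> (N0 <= N)%N ->
  forall phi : R -> R, phi Q <= X ^+ m ->
  exists2 C : set 'cV[int]_(m + n), congruence_class N C & ~ solvable_in B N Q phi C.
Proof.
move=> m0 n0 X0 Y0 QY vol.
have : \forall e \near (0 : R), (2 * X + e) ^+ m * (Y + e) ^+ n < 1.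
  have : (2 * X + e) ^+ m * (Y + e) ^+ n @[e --> 0] --> (2 * X + 0) ^+ m * (Y + 0) ^+ n.
    have cX k (c : R) : (c + e) ^+ k @[e --> 0] --> (c + 0) ^+ k.
      apply: (@cvg_comp _ _ _ (fun e => c + e) (fun e => e ^+ k) _ (nbhs (c + 0))).
        by apply: cvgD; [exact: cvg_cst|exact: cvg_id].
      exact: exprn_continuous.
    by apply: cvgM; exact: cX.
  by rewrite !addr0 => /cvgr_lt; exact.
move=> [d /= d0 hd].
exists (Num.truncn d^-1).+1 => N N0 dN phi phiX.
have NR : 0 < N%:R :> R by rewrite ltr0n.
apply: contrapT => noC.
have solv (C : set 'cV[int]_(m + n)) : congruence_class N C -> solvable_in B N Q phi C.
  by move=> CC; apply: contrapT => nC; apply: noC; exists C.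
have := card_classes_le m n B N X Y Q phi m0 n0 N0 X0 Y0 phiX QY solv.
apply/negP; rewrite -ltnNge -(ltr_nat R) natrM !natrX.
have {}hd : (2 * X + N%:R^-1) ^+ m * (Y + N%:R^-1) ^+ n < 1.
  apply: hd; rewrite /ball_ /= sub0r normrN gtr0_norm ?invr_gt0//.
  rewrite invf_plt ?posrE//; apply: lt_le_trans (truncnS_gt d^-1) _.
  by rewrite ler_nat.
apply: (@le_lt_trans _ _ ((2 * N%:R * X + 1) ^+ m * (N%:R * Y + 1) ^+ n)).
  have tr (x : R) : 0 <= x -> (Num.truncn x).+1%:R <= x + 1.
    by move=> x0; rewrite -natr1 lerD2r truncn_le.
  have [XR YR] : 0 <= 2 * N%:R * X /\ 0 <= N%:R * Y.
    by rewrite !mulr_ge0 ?ltW.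
  by apply: ler_pM; rewrite ?exprn_ge0// lerXn2r ?nnegrE ?addr_ge0// tr.
have -> : 2 * N%:R * X + 1 = N%:R * (2 * X + N%:R^-1) by field; rewrite gt_eqF.
have -> : N%:R * Y + 1 = N%:R * (Y + N%:R^-1) by field; rewrite gt_eqF.
by rewrite !exprMn mulrACA -exprD gtr_pMr// exprn_gt0.
Qed.

End counting.

(** * Measure of the matrices with nearly integral linear forms *)

Lemma measure_bigsetU_le d (T : measurableType d) (R : realType)
    (mu : {measure set T -> \bar R}) (I : Type) (s : seq I) (P : pred I)
    (F : I -> set T) (b : R) : 0 <= b ->
  (forall i, P i -> measurable (F i) /\ (mu (F i) <= b%:E)%E) ->
  (mu (\big[setU/set0]_(i <- s | P i) F i) <= ((size s)%:R * b)%:E)%E.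
Proof.
move=> b0 hF; elim: s => [|i s IHs]; first by rewrite big_nil measure0 mul0r.
have mU : measurable (\big[setU/set0]_(i <- s | P i) F i).
  by apply: bigsetU_measurable => j /hF[].
rewrite big_cons /= -natr1 mulrDl mul1r EFinD; case: ifPn => Pi.
  have [mFi bFi] := hF i Pi.
  by rewrite addeC; apply: le_trans (measureU2 _ mFi mU) _; rewrite leeD.
by apply: le_trans IHs _; rewrite leeDl// lee_fin.
Qed.

(** A crude form of Fubini's theorem: bound the sections uniformly. *)
Lemma product_measure_le d1 d2 (T1 : measurableType d1) (T2 : measurableType d2)
    (R : realType) (m1 : {measure set T1 -> \bar R})
    (m2 : {sigma_finite_measure set T2 -> \bar R}) (A : set (T1 * T2))
    (X : set T1) (b : R) : measurable A -> measurable X -> 0 <= b ->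
  (forall x, X x -> (m2 (xsection A x) <= b%:E)%E) ->
  (forall x y, A (x, y) -> X x) ->
  ((m1 \x m2) A <= b%:E * m1 X)%E.
Proof.
move=> mA mX b0 hX AX.
rewrite -[X in (_ * m1 X)%E]setIT -(integral_indic m1 measurableT mX).
rewrite -ge0_integralZl_EFin//; last first.
  by apply/measurable_EFinP; exact: measurable_indic.
apply: ge0_le_integral => //=.
- exact: measurable_fun_xsection.
- by apply: measurable_funeM; apply/measurable_EFinP; exact: measurable_indic.
- move=> x _; rewrite indicE; have [xX|xX] := boolP (x \in X).
    by rewrite mule1; apply: hX; rewrite inE in xX.
  rewrite mule0 (_ : xsection A x = set0) ?measure0//.
  apply/seteqP; split => // y; rewrite /xsection /= inE => /AX Xx.
  by move/negP : xX; apply; rewrite inE.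
Qed.

Section near_int.
Context {R : realType}.
Local Notation RT := (measurableTypeR R).

Definition near_int (delta : R) : set R :=
  [set y | exists z : int, `|y - z%:~R| <= delta].

Lemma measurable_near_int delta : measurable (near_int delta : set RT).
Proof.
rewrite (_ : near_int delta = \bigcup_(z : int) `[z%:~R - delta, z%:~R + delta]%classic).
  apply: countable_bigcupT_measurable => [|z]; last exact: measurable_itv.
  exact: countableP.
apply/seteqP; split=> y [z].
  by rewrite ler_distl => h; exists z => //=; rewrite in_itv /=.
by move=> _ /=; rewrite in_itv /= -ler_distl => h; exists z.
Qed.

Lemma measurable_near_int_affine (M delta a c : R) :
  measurable [set x : RT | `|x| <= M /\ near_int delta (c + a * x)].
Proof.
rewrite (_ : [set _ | _] = `[- M, M]%classic `&`
    (fun x : RT => (c + a * x : RT)) @^-1` near_int delta); last first.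
  by apply/seteqP; split=> x /=; rewrite in_itv /= -ler_norml.
apply: measurableI; first exact: measurable_itv.
rewrite -[X in measurable X]setTI.
have : measurable_fun [set: RT] (fun x : RT => (c + a * x : RT)).
  by apply: measurable_funD => //; apply: measurable_funM.
by apply => //; exact: measurable_near_int.
Qed.

(** On [[- M, M]] the function [c + a x] comes near at most
    [2 (|a| M + delta) + 2] integers, each of them on an interval of length
    [2 delta / |a|]; the factors [|a|] cancel, up to the bounded number of boundary
    terms, because [1 <= |a|]. *)
Lemma lebesgue_near_int_affine (M delta a c : R) : 0 <= M -> 0 <= delta ->
  1 <= `|a| ->
  (lebesgue_measure [set x : RT | (`|x| <= M)%R /\ near_int delta (c + a * x)%R]
   <= (4 * (M + delta + 1) * delta)%:E)%E.
Proof.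
move=> M0 delta0 a1.
have a0 : 0 < `|a| by exact: lt_le_trans a1.
have an0 : a != 0 by rewrite -normr_gt0.
pose b := `|a|.
pose z0 := Num.floor (c - b * M - delta).
pose K := (Num.truncn (2 * (b * M + delta))).+2.
pose F (i : 'I_K) := `[ (z0%:~R + i%:R - c) / a - delta / b,
                   (z0%:~R + i%:R - c) / a + delta / b]%classic : set RT.
have bR : 0 <= b by exact: ltW.
have bM : 0 <= b * M by rewrite mulr_ge0.
have sub : [set x : RT | `|x| <= M /\ near_int delta (c + a * x)] `<=`
    \big[setU/set0]_(i <- enum 'I_K) F i.
  move=> x /= [xM [z hz]].
  have axM : `|a * x| <= b * M by rewrite normrM ler_wpM2l.
  move: (hz); rewrite ler_distl => /andP[h1 h2].
  move: axM; rewrite ler_norml => /andP[h3 h4].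
  have z0z : z0 <= z.
    rewrite -(ler_int R); apply: le_trans (floor_le _) _.
    by lra.
  have kE : (absz (z - z0)%R : int) = z - z0 by rewrite gez0_abs// subr_ge0.
  have kR : (absz (z - z0)%R)%:R = (z - z0)%:~R :> R by rewrite -kE.
  have kK : (absz (z - z0)%R < K)%N.
    rewrite -(ltr_nat R) kR /K -natr1.
    have := floorD1_gt (c - b * M - delta).
    have := truncnS_gt (2 * (b * M + delta)).
    rewrite -/z0 !intrD rmorphN /=; lra.
  rewrite -bigcup_seq; exists (Ordinal kK) => /=; first by rewrite mem_enum.
  rewrite /F /= kR in_itv /= -ler_distl.
  have -> : x - (z0%:~R + (z - z0)%:~R - c) / a = (c + a * x - z%:~R) / a.
    by rewrite intrD rmorphN /=; field.
  by rewrite normrM normfV ler_pM2r// invr_gt0.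
have mF i : measurable (F i) by exact: measurable_itv.
have FE i : (lebesgue_measure (F i) <= (2 * delta / b)%:E)%E.
  rewrite lebesgue_measure_itv /=; case: ifPn => _; last first.
    by rewrite lee_fin mulr_ge0 ?invr_ge0// mulr_ge0.
  by rewrite -EFinB lee_fin; lra.
apply: le_trans (le_measure lebesgue_measure _ _ sub) _.
- by rewrite inE; exact: measurable_near_int_affine.
- by rewrite inE; apply: bigsetU_measurable => i _; exact: mF.
have db0 : 0 <= 2 * delta / b by rewrite mulr_ge0 ?invr_ge0// mulr_ge0.
apply: le_trans (measure_bigsetU_le _ _ _ lebesgue_measure _ _ xpredT F _ db0 _) _.
  by move=> i _; split; [exact: mF|exact: FE].
rewrite lee_fin size_enum_ord /K -[_.+2]addn2 natrD.
have tr : (Num.truncn (2 * (b * M + delta)))%:R <= 2 * (b * M + delta).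
  by rewrite truncn_le mulr_ge0// addr_ge0.
apply: (@le_trans _ _ ((2 * (b * M + delta) + 2) * (2 * delta / b))).
  by rewrite ler_wpM2r// lerD2r.
have -> : (2 * (b * M + delta) + 2) * (2 * delta / b) =
    4 * (M + (delta + 1) / b) * delta by field; rewrite gt_eqF.
rewrite ler_wpM2r// ler_wpM2l// -addrA lerD2l ler_pdivrMr//.
by rewrite ler_peMr// addr_ge0.
Qed.

(** The coordinates are distributed by [col] among [n] affine forms with disjoint
    sets of variables, of which those in [J] are required to be near an integer.
    Flexible [c] and [J] are what makes induction on the number of coordinates
    possible. *)
Definition slab n k (J : {set 'I_n}) (col : 'I_k -> 'I_n) (a : 'I_k -> R)
    (c : 'I_n -> R) (M delta : R) : set (k.-tuple RT) :=
  [set t : k.-tuple RT | (forall i, `|tnth t i : R| <= M) /\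
    forall j, j \in J ->
    near_int delta (c j + \sum_(i | col i == j) a i * tnth t i)].

Lemma measurable_slab n k J col a c M delta :
  measurable (slab n k J col a c M delta).
Proof.
rewrite (_ : slab _ _ _ _ _ _ _ _ =
  [set t : k.-tuple RT | forall i, (`[- M, M]%classic : set RT) (tnth t i)] `&`
  \bigcap_(j in [set j | j \in J])
    ((fun t : k.-tuple RT => c j + \sum_(i | col i == j) a i * tnth t i : RT)
       @^-1` near_int delta)); last first.
  apply/seteqP; split => t /= [h1 h2]; split => // i.
    by rewrite in_itv /= -ler_norml.
  by have := h1 i; rewrite in_itv /= -ler_norml.
apply: measurableI.
  apply: (@measurable_tuple_box R k (fun _ => `[- M, M]%classic)) => i.
  exact: measurable_itv.
apply: fin_bigcap_measurable; first exact: finite_finset.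
move=> j _; rewrite -[X in measurable X]setTI.
have : measurable_fun [set: k.-tuple RT]
    (fun t : k.-tuple RT => (c j + \sum_(i | col i == j) a i * tnth t i : RT)).
  apply: measurable_funD => //.
  rewrite [X in measurable_fun _ X](_ : _ = fun t : k.-tuple RT =>
      \sum_i if col i == j then a i * tnth t i else 0 : RT); last first.
    by apply/funext => t; exact: big_mkcond.
  apply: measurable_sum => i; case: (col i == j) => //.
  apply: measurable_funM => //; exact: measurable_tnth.
by apply => //; exact: measurable_near_int.
Qed.

Lemma slab_section n k J col a c M delta x :
  let col' i := col (lift ord0 i) in let a' i := a (lift ord0 i) in
  xsection (@tcons R k @^-1` slab n k.+1 J col a c M delta) x `<=`
  slab n k J col' a'
    (fun j => c j + (if j == col ord0 then a ord0 * x else 0)) M delta.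
Proof.
move=> col' a' t; rewrite /xsection /= inE /= => -[h1 h2]; split.
  by move=> i; have := h1 (lift ord0 i); rewrite tnthS.
move=> j jJ; have := h2 j jJ.
rewrite big_mkcond big_ord_recl /= eq_sym addrA -big_mkcond /=.
under eq_bigr do rewrite tnthS.
by [].
Qed.

(** Each of the conditions [j \in J] costs a factor [delta].  The coordinates are
    integrated out one after the other; the condition [j] is used with the last
    coordinate of colour [j] whose coefficient is nonzero, all others being only
    confined to [[- M, M]]. *)
Lemma lebesgue_slab_le n k (J : {set 'I_n}) (col : 'I_k -> 'I_n) (a : 'I_k -> R)
    (c : 'I_n -> R) (M delta : R) : 0 <= M -> 0 <= delta ->
  (forall i, a i = 0 \/ 1 <= `|a i|) ->
  (forall j, j \in J -> exists2 i, col i = j & 1 <= `|a i|) ->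
  (lebesgue_tuple R k (slab n k J col a c M delta) <=
   ((4 * (M + delta + 1)) ^+ k * delta ^+ #|J|)%:E)%E.
Proof.
move=> M0 d0; set W := 4 * (M + delta + 1).
have W0 : 0 <= W by rewrite mulr_ge0// !addr_ge0.
elim: k J col a c => [|k IHk] J col a c ha hJ.
  have -> : J = finset.set0 by apply/setP => j; rewrite !inE; apply/negP => /hJ[[]].
  by rewrite cards0 mulr1 /= diracE lee_fin; case: (_ \in _).
have ha' i : a (lift ord0 i) = 0 \/ 1 <= `|a (lift ord0 i)| by exact: ha.
(* integrating out the first coordinate *)
have step (J' : {set 'I_n}) (X : set RT) (b : R) : measurable X -> 0 <= b ->
    (lebesgue_measure X <= (W * b)%:E)%E -> b * delta ^+ #|J'| = delta ^+ #|J| ->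
    J' \subset J ->
    (forall j, j \in J' -> exists2 i, col (lift ord0 i) = j & 1 <= `|a (lift ord0 i)|) ->
    (forall x t, slab n k.+1 J col a c M delta (tcons (x, t)) -> X x) ->
    (lebesgue_tuple R k.+1 (slab n k.+1 J col a c M delta) <=
      (W ^+ k.+1 * delta ^+ #|J|)%:E)%E.
  move=> mX b0 hX hb JJ hJ' sX.
  have mA : measurable (@tcons R k @^-1` slab n k.+1 J col a c M delta).
    rewrite -[X in measurable X]setTI; apply: measurable_tcons => //.
    exact: measurable_slab.
  have B0 : 0 <= W ^+ k * delta ^+ #|J'| by rewrite mulr_ge0 ?exprn_ge0.
  rewrite /= /pushforward.
  apply: le_trans (product_measure_le _ _ _ _ _ lebesgue_measure
    (lebesgue_tuple R k) _ X (W ^+ k * delta ^+ #|J'|) mA mX B0 _ _) _.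
  - move=> x _; apply: le_trans (IHk J' _ _ _ ha' hJ'); apply: le_measure.
    + by rewrite inE; exact: measurable_xsection.
    + by rewrite inE; exact: measurable_slab.
    apply: subset_trans (@slab_section _ _ _ _ _ _ _ _ _) _.
    by move=> t [h1 h2]; split => // j /(fintype.subsetP JJ); exact: h2.
  - by move=> x t /sX.
  apply: le_trans (lee_wpmul2l _ hX) _; first by rewrite lee_fin.
  rewrite -EFinM lee_fin -hb exprS le_eqVlt; apply/orP; left; apply/eqP.
  by ring.
have [hP|nP] := pselect (col ord0 \in J ->
    exists2 i, col (lift ord0 i) = col ord0 & 1 <= `|a (lift ord0 i)|).
  apply: (step J `[-M, M]%classic 1) => //.
  - by rewrite lebesgue_measure_itv /= mulr1; case: ifPn => _;
      rewrite lee_fin /W; lra.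
  - by rewrite mul1r.
  - move=> j jJ; have [i ij ai] := hJ j jJ.
    case: (unliftP ord0 i) ij ai => [i' ->|->] ij ai.
      by exists i'.
    by rewrite -ij; apply: hP; rewrite ij.
  - move=> x t [h _]; have := h ord0; rewrite /= in_itv /= -ler_norml.
    by rewrite /tnth /=.
have [J0 nP'] : col ord0 \in J /\
    ~ exists2 i, col (lift ord0 i) = col ord0 & 1 <= `|a (lift ord0 i)|.
  by split; [apply: contrapT => h; apply: nP | move=> h; apply: nP].
have a0 : 1 <= `|a ord0|.
  have [i ij ai] := hJ _ J0; case: (unliftP ord0 i) ij ai => [i' ->|->] // ij ai.
  by case: nP'; exists i'.
apply: (step (J :\ col ord0)
   [set x : RT | `|x| <= M /\ near_int delta (c (col ord0) + a ord0 * x)] delta) => //.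
- exact: measurable_near_int_affine.
- exact: lebesgue_near_int_affine.
- by rewrite -exprS (cardsD1 (col ord0) J) J0.
- exact: subD1set.
- move=> j; rewrite in_setD1 => /andP[j0 jJ]; have [i ij ai] := hJ j jJ.
  case: (unliftP ord0 i) ij ai => [i' ->|->] ij ai; first by exists i'.
  by move: j0; rewrite -ij eqxx.
- move=> x t [h1 h2]; split; first exact: (h1 ord0).
  have := h2 _ J0; rewrite big_mkcond big_ord_recl /= eqxx big1 ?addr0//.
  move=> i _; case: ifPn => // /eqP ci.
  by have [->|a1] := ha' i; [rewrite mul0r | case: nP'; exists i].
Qed.

End near_int.

(** * The convergence part of the Khintchine-Groshev theorem *)

Section groshev.
Context {R : realType}.
Local Notation RT := (measurableTypeR R).

Definition near_int_row m n (B : 'M[R]_(m, n)) (u : 'rV[int]_m) (delta : R) : Prop :=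
  forall j, near_int delta ((map_mx intr u *m B) 0 j).

(** The columns of the matrix are independent variables, and the entries of [u *m B]
    are linear forms in them, all with the coefficients of [u]. *)
Lemma near_int_row_slab m n (u : 'rV[int]_m) : u != 0 ->
  exists (col : 'I_(m * n) -> 'I_n) (a : 'I_(m * n) -> R),
  [/\ forall i, a i = 0 \/ 1 <= `|a i|,
      forall j, exists2 i, col i = j & 1 <= `|a i| &
      forall M delta, slab n (m * n) finset.setT col a (fun=> 0) M delta =
       [set t | (forall i, `|tnth t i : R| <= M) /\
                near_int_row m n (mx_of_tuple t) u delta]].
Proof.
move=> u0; have [g gK Kg] := curry_mxvec_bij m n.
have {}gK i j : g (mxvec_index i j) = (i, j) by rewrite -(gK (i, j)).
have int_ge1 (z : int) : z != 0 -> 1 <= `|z%:~R : R|.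
  by move=> z0; rewrite -intr_norm -[1]/(1%:~R) ler_int -gtz0_ge1 normr_gt0.
exists (fun i => (g i).2), (fun i => (u 0 (g i).1)%:~R); split.
- move=> i; have [->|z0] := eqVneq (u 0 (g i).1) 0; first by left.
  by right; exact: int_ge1.
- move=> j; have [i ui] : exists i, u 0 i != 0.
    apply: contrapT => h; move/eqP : u0; apply; apply/rowP => i; rewrite mxE.
    by apply/eqP/negPn/negP => ui; apply: h; exists i.
  by exists (mxvec_index i j); rewrite gK //; exact: int_ge1.
move=> M delta.
have sumE (t : (m * n).-tuple RT) j :
    \sum_(i | (g i).2 == j) (u 0 (g i).1)%:~R * tnth t i =
    (map_mx intr u *m mx_of_tuple t) 0 j :> R.
  rewrite mxE (reindex (uncurry (@mxvec_index m n))) /=; last first.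
    by exists g => [[i j'] _|i _]; [exact: gK|exact: Kg].
  rewrite (eq_bigr (fun p : 'I_m * 'I_n =>
    (u 0 p.1)%:~R * tnth t (mxvec_index p.1 p.2))); last first.
    by move=> [i j'] _ /=; rewrite gK.
  rewrite (eq_bigl (fun p : 'I_m * 'I_n => xpredT p.1 && (p.2 == j))); last first.
    by move=> [i j'] /=; rewrite gK.
  rewrite -(pair_big xpredT (pred1 j)
    (fun i j => (u 0 i)%:~R * tnth t (mxvec_index i j))) /=.
  by apply: eq_bigr => i _; rewrite big_pred1_eq !mxE.
apply/seteqP; split => t /= [h1 h2]; split => // j.
  by have := h2 j (finset.in_setT _); rewrite add0r sumE.
by move=> _; rewrite add0r sumE; exact: h2.
Qed.

(** An enumeration by a finite type of the integer rows with entries in [[- K, K]]. *)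
Definition int_cube m (K : nat) (g : {ffun 'I_m -> 'I_(2 * K).+1}) : 'rV[int]_m :=
  \row_i ((g i)%:Z - K%:Z).

Lemma int_cubeP m (K : nat) (u : 'rV[int]_m) :
  (forall i, `|(u 0 i)%:~R| <= K%:R :> R) -> exists g, u = int_cube m K g.
Proof.
move=> hu; exists [ffun i => inord (absz (u 0 i + K%:Z))].
apply/rowP => i; rewrite mxE ffunE.
have : `|u 0 i| <= K%:Z.
  by have := hu i; rewrite -intr_norm -[K%:R]/(K%:Z%:~R) ler_int.
rewrite ler_norml => /andP[h1 h2].
have kE : (absz (u 0 i + K%:Z)%R : int) = u 0 i + K%:Z.
  by rewrite gez0_abs// -lerBlDr sub0r.
rewrite inordK ?kE ?addrK//.
by rewrite ltnS -lez_nat kE mul2n -addnn PoszD lerD2r.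
Qed.

Definition near_int_row_event m n (M U delta : R) : set ((m * n).-tuple RT) :=
  \big[setU/set0]_(g : {ffun 'I_m -> 'I_(2 * Num.truncn U).+1} | int_cube m _ g != 0)
    [set t | (forall i, `|tnth t i : R| <= M) /\
             near_int_row m n (mx_of_tuple t) (int_cube m _ g) delta].

Lemma measurable_near_int_row_event m n M U delta :
  measurable (near_int_row_event m n M U delta).
Proof.
apply: bigsetU_measurable => g g0.
have [col [a [_ _ <-]]] := near_int_row_slab m n _ g0.
exact: measurable_slab.
Qed.

(** If [U < 1] there is no nonzero row; otherwise there are at most [(3 U) ^ m]. *)
Lemma lebesgue_near_int_row_event m n (M U delta : R) :
  0 <= M -> 0 <= U -> 0 <= delta ->
  (lebesgue_tuple R (m * n) (near_int_row_event m n M U delta) <=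
   (3 ^+ m * (4 * (M + delta + 1)) ^+ (m * n) * (U ^+ m * delta ^+ n))%:E)%E.
Proof.
move=> M0 U0 d0; set W := 4 * (M + delta + 1).
have W0 : 0 <= W by rewrite mulr_ge0// !addr_ge0.
have [K0|K0] := posnP (Num.truncn U).
  rewrite /near_int_row_event big_pred0 => [|g].
    by rewrite measure0 lee_fin !mulr_ge0 ?exprn_ge0.
  apply/negbTE/negPn/eqP/rowP => i; rewrite !mxE.
  move: (nat_of_ord (g i)) (ltn_ord (g i)) => x.
  by rewrite K0 muln0 ltnS leqn0 => /eqP ->.
have b0 : 0 <= W ^+ (m * n) * delta ^+ n by rewrite mulr_ge0 ?exprn_ge0.
apply: le_trans (measure_bigsetU_le _ _ _ (lebesgue_tuple R (m * n)) _ _ _ _ _ b0 _) _.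
  move=> g g0; have [col [a [ha hJ <-]]] := near_int_row_slab m n _ g0.
  split; first exact: measurable_slab.
  have := lebesgue_slab_le n (m * n) finset.setT col a (fun=> 0) M delta
    M0 d0 ha (fun j _ => hJ j).
  by rewrite cardsT card_ord.
rewrite lee_fin.
have -> : size (index_enum {ffun 'I_m -> 'I_(2 * Num.truncn U).+1}) =
    ((2 * Num.truncn U).+1 ^ m)%N.
  by rewrite [index_enum _]unlock -enumT -cardE card_ffun !card_ord.
have -> : 3 ^+ m * W ^+ (m * n) * (U ^+ m * delta ^+ n) =
  (3 * U) ^+ m * (W ^+ (m * n) * delta ^+ n) by rewrite (exprMn m 3 U); ring.
rewrite ler_wpM2r// natrX lerXn2r ?nnegrE ?mulr_ge0//.
have tU : (Num.truncn U)%:R <= U by rewrite truncn_le.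
have : 1 <= (Num.truncn U)%:R :> R by rewrite ler1n.
by rewrite -natr1 natrM; lra.
Qed.

(** The convergence part of the Khintchine-Groshev theorem: the Borel-Cantelli lemma
    for the matrices with entries in [[- M, M]], and then a union over [M]. *)
Theorem groshev_convergence m n (U delta : nat -> R) (D : R) :
  (forall k, 0 <= U k) -> (forall k, 0 <= delta k <= D) ->
  (\sum_(k <oo) (U k ^+ m * delta k ^+ n)%:E < +oo)%E ->
  ae_matrix (fun B : 'M[R]_(m, n) => exists k0 : nat, forall k, (k0 <= k)%N ->
    forall u : 'rV[int]_m, u != 0 -> (forall i, `|(u 0 i)%:~R| <= U k) ->
    ~ near_int_row m n B u (delta k)).
Proof.
move=> U0 d0 sumoo.
have D0 : 0 <= D by have /andP[h0 hD] := d0 0%N; exact: le_trans hD.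
pose E (M k : nat) := near_int_row_event m n M%:R (U k) (delta k).
have limsup0 M : (lebesgue_tuple R (m * n)).-negligible (lim_sup_set (E M)).
  apply/negligibleP.
    apply: bigcapT_measurable => k; apply: bigcup_measurable => i _.
    exact: measurable_near_int_row_event.
  apply: lim_sup_set_cvg0 => [k|]; first exact: measurable_near_int_row_event.
  pose c : R := 3 ^+ m * (4 * (M%:R + D + 1)) ^+ (m * n).
  apply: (@le_lt_trans _ _ (\sum_(k <oo) (c%:E * (U k ^+ m * delta k ^+ n)%:E))%E).
    apply: lee_nneseries => [k _ _|k _]; first exact: measure_ge0.
    have /andP[dk0 dkD] := d0 k.
    apply: le_trans (lebesgue_near_int_row_event _ _ _ _ _ _ _ _) _ => //.
    rewrite -EFinM lee_fin ler_wpM2r ?mulr_ge0 ?exprn_ge0//.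
    rewrite ler_wpM2l ?exprn_ge0// lerXn2r ?nnegrE ?mulr_ge0 ?addr_ge0//.
    by rewrite ler_wpM2l// lerD2r lerD2l.
  rewrite nneseriesZl; last first.
    by move=> k _; have /andP[dk0 _] := d0 k; rewrite lee_fin mulr_ge0 ?exprn_ge0.
  by rewrite lte_mul_pinfty// lee_fin mulr_ge0 ?exprn_ge0// mulr_ge0// !addr_ge0.
apply: negligibleS (negligible_bigcup limsup0) => t /= nt.
have [M hM] : exists M : nat, forall i, `|tnth t i : R| <= M%:R.
  exists (Num.truncn (\sum_i `|tnth t i : R|)).+1 => i.
  apply: le_trans (ltW (truncnS_gt _)).
  by rewrite (bigD1 i)//= lerDl sumr_ge0.
exists M => // k0 _; apply: contrapT => nk; apply: nt; exists k0 => k kk0 u u0 hu hB.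
apply: nk; exists k => //; rewrite /E /near_int_row_event.
have [g uE] : exists g, u = int_cube m (Num.truncn (U k)) g.
  apply: int_cubeP => i; have := hu i.
  rewrite -intr_norm -[(Num.truncn _)%:R]/(Num.truncn (U k))%:Z%:~R.
  rewrite -floor_ge_int ler_int => h.
  by apply: le_trans h _; rewrite truncn_floor U0 gez0_abs// floor_ge0.
rewrite -bigcup_seq_cond; exists g => /=; first by rewrite mem_index_enum -uE.
by rewrite -uE.
Qed.
End groshev.

(** * Both parts for all sufficiently large Q *)

Lemma ae_matrixS (R : realType) m n (P Q : 'M[R]_(m, n) -> Prop) :
  (forall B, P B -> Q B) -> ae_matrix P -> ae_matrix Q.
Proof. by move=> PQ; apply: negligibleS => t /= nQ /PQ. Qed.

Lemma ae_matrix_all (R : realType) m n (P : 'M[R]_(m, n) -> Prop) :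
  (forall B, P B) -> ae_matrix P.
Proof.
move=> hP; apply: negligibleS (negligible_set0 _) => t /=; exact.
Qed.

Lemma rootK (R : realType) (k : nat) (x : R) : (0 < k)%N -> 0 <= x ->
  (x `^ k%:R^-1) ^+ k = x.
Proof.
move=> k0 x0; rewrite -powR_mulrn ?powR_ge0// -powRrM mulVf ?powRr1//.
by rewrite pnatr_eq0 -lt0n.
Qed.

Lemma ge1_of_exprn (R : realType) (k : nat) (x : R) : (0 < k)%N -> 0 <= x ->
  1 <= x ^+ k -> 1 <= x.
Proof. by move=> k0 x0; rewrite -{1}(expr1n R k) ler_pXn2r// nnegrE. Qed.

Lemma unbounded_of_summable_inverse (R : realType) (f : R -> R) :
  positive_on_pos f ->
  (\sum_(1 <= k <oo) ((f k%:R)^-1)%:E < +oo)%E ->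
  forall A : R, exists2 k : nat, (0 < k)%N & A < f k%:R.
Proof.
move=> f_pos f_sum A; apply: contrapT => h.
have fA k : (0 < k)%N -> 0 < f k%:R <= A.
  move=> k0; rewrite f_pos ?ltr0n//= leNgt; apply/negP => Af.
  by apply: h; exists k.
have A0 : 0 < A by have /andP[f1 fA1] := fA 1%N isT; exact: lt_le_trans fA1.
have part (K : nat) : ((K%:R / A)%:E <= \sum_(1 <= k <oo) ((f k%:R)^-1)%:E)%E.
  apply: le_trans (nneseries_lim_ge K.+1 _); last first.
    by move=> k k1 _; rewrite lee_fin invr_ge0 ltW//; have /andP[] := fA k k1.
  rewrite sumEFin lee_fin.
  have -> : K%:R / A = \sum_(1 <= k < K.+1) A^-1 :> R.
    by rewrite sumr_const_nat subn1 /= mulr_natl.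
  apply: ler_sum_nat => k /andP[k1 _]; have /andP[fk0 fkA] := fA k k1.
  by rewrite lef_pV2 ?posrE.
set S := (\sum_(1 <= k <oo) _)%E in f_sum part.
have Sfin : S \is a fin_num.
  rewrite ge0_fin_numE//; apply: le_trans (part 0%N).
  by rewrite mul0r.
have := part (Num.truncn (fine S * A)).+1.
rewrite -(fineK Sfin) lee_fin ler_pdivrMr// leNgt => /negP; apply.
exact: truncnS_gt.
Qed.

(** The volume [2 ^ m * f (ln Q) ^ (- 1 / m)] of the box is less than one as soon as
    [f (ln Q)] exceeds [(2 ^ m) ^ m]. *)
Lemma unsolvable_everywhere (R : realType) (m n : nat) (f : R -> R)
    (B : 'M[R]_(m, n)) : (0 < m)%N -> (0 < n)%N ->
  positive_on_pos f -> increasing_on_pos f ->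
  (\sum_(1 <= k <oo) ((f k%:R)^-1)%:E < +oo)%E ->
  exists2 Q0 : R, 1 < Q0 & forall Q : R, Q0 <= Q ->
  exists N0 : nat, forall N : nat, (0 < N)%N -> (N0 <= N)%N ->
  forall phi : R -> R, phi Q <= Q^-1 * f (ln Q) `^ (- m%:R^-1) ->
  exists2 C : set 'cV[int]_(m + n), congruence_class N C &
  ~ solvable_in B N Q phi C.
Proof.
move=> m0 n0 f_pos f_incr f_sum.
have [k k0 fk] := unbounded_of_summable_inverse R f f_pos f_sum ((2 ^+ m) ^+ m).
have kR : 0 < k%:R :> R by rewrite ltr0n.
have Q01 : 1 < expR k%:R :> R by rewrite expR_gt1.
exists (expR k%:R) => // Q Q0Q.
have Qpos : 0 < Q by rewrite (lt_le_trans _ Q0Q)// expR_gt0.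
have klnQ : k%:R <= ln Q by rewrite -[leLHS]expRK ler_ln ?posrE ?expR_gt0.
have fQ : (2 ^+ m) ^+ m < f (ln Q) by apply: lt_le_trans fk _; exact: f_incr.
have fQ0 : 0 < f (ln Q) by exact/f_pos/(lt_le_trans kR).
pose F := f (ln Q) `^ m%:R^-1.
have F0 : 0 < F by exact: powR_gt0.
have F2 : 2 ^+ m < F.
  by rewrite -(@ltr_pXn2r _ m)// ?nnegrE ?exprn_ge0 ?ltW// rootK// ltW.
have V0 : 0 < Q^-1 * F^-1 by rewrite mulr_gt0// invr_gt0.
have FE : f (ln Q) `^ (- m%:R^-1) = F^-1 by rewrite powRN.
have XE := rootK R m _ m0 (ltW V0).
have YE := rootK R n _ n0 (ltW Qpos).
have vol : (2 * (Q^-1 * F^-1) `^ m%:R^-1) ^+ m * (Q `^ n%:R^-1) ^+ n < 1.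
  rewrite exprMn XE YE.
  rewrite (_ : _ * Q = 2 ^+ m / F); last by field; rewrite !gt_eqF.
  by rewrite ltr_pdivrMr// mul1r.
have [N0 hN0] := unsolvable_class m n B _ _ Q m0 n0 (powR_gt0 _ V0)
  (powR_gt0 _ Qpos) (esym YE) vol.
exists N0 => N N_gt0 NN0 phi hphi; apply: hN0 => //.
by rewrite XE -FE.
Qed.

(** The scales are [Q = e ^ (k + 1)], since [f] is only controlled at positive
    arguments; [U k] and [delta k] are the worst bounds on a short dual vector for
    [Q] between [e ^ (k + 1)] and [e ^ (k + 2)], and [U k ^ m * delta k ^ n] is a
    constant times [1 / f (k + 1)]. *)
Lemma solvable_almost_everywhere (R : realType) (m n : nat) (f : R -> R) :
  (0 < m)%N -> (0 < n)%N ->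
  positive_on_pos f -> increasing_on_pos f ->
  (\sum_(1 <= k <oo) ((f k%:R)^-1)%:E < +oo)%E ->
  ae_matrix (fun B : 'M[R]_(m, n) => exists2 Q0 : R, 1 < Q0 &
    forall Q : R, Q0 <= Q -> forall phi : R -> R, Q^-1 * f (ln Q) <= phi Q ->
    forall (N : nat) (C : set 'cV[int]_(m + n)), (0 < N)%N ->
    congruence_class N C -> solvable_in B N Q phi C).
Proof.
move=> m0 n0 f_pos f_incr f_sum.
pose T : R := 1 + 3 ^+ (m + n).
have T1 : 1 <= T by rewrite /T lerDl exprn_ge0.
have T0 : 0 < T by exact: lt_le_trans T1.
have f0 k : 0 < f k.+1%:R by rewrite f_pos// ltr0n.
pose P k := expR k.+2%:R / f k.+1%:R.
have P0 k : 0 < P k by rewrite divr_gt0 ?expR_gt0.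
pose U k := T * P k `^ m%:R^-1.
pose delta k := 2 * T * expR (- k.+1%:R) `^ n%:R^-1.
have sumUd : (\sum_(k <oo) (U k ^+ m * delta k ^+ n)%:E < +oo)%E.
  pose c := T ^+ m * (2 * T) ^+ n * expR 1.
  have Udc k : U k ^+ m * delta k ^+ n = c * (f k.+1%:R)^-1.
    rewrite /U /delta !exprMn !rootK ?expR_ge0 ?(ltW (P0 k))// /P /c.
    have -> : expR 1 = expR k.+2%:R * expR (- k.+1%:R) :> R.
      by rewrite -expRD -natr1 addrAC subrr add0r.
    by rewrite !exprMn; ring.
  apply: (@le_lt_trans _ _ (\sum_(k <oo) (c%:E * ((f k.+1%:R)^-1)%:E))%E).
    apply: lee_nneseries => [k _ _|k _]; last by rewrite -EFinM Udc.
    by rewrite lee_fin mulr_ge0// exprn_ge0// !mulr_ge0 ?powR_ge0 ?ltW.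
  rewrite nneseriesZl; last by move=> k _; rewrite lee_fin invr_ge0 ltW.
  rewrite lte_mul_pinfty// ?lee_fin ?mulr_ge0 ?exprn_ge0 ?expR_ge0 ?mulr_ge0 ?(ltW T0)//.
  (* g vanishes at 0, where nothing is known of the sign of f *)
  pose g k : \bar R := (if k is k'.+1 then (f k'.+1%:R)^-1 else 0)%:E.
  have g0 k : (0 <= g k)%E.
    by case: k => [|k]; rewrite lee_fin// invr_ge0 ltW.
  apply: (@le_lt_trans _ _ (\sum_(0 <= k <oo) g (k + 1)%N)%E).
    apply: lee_nneseries => [k _ _|k _]; last by rewrite addn1.
    by rewrite lee_fin invr_ge0 ltW.
  rewrite nneseries_addn//.
  suff -> : (\sum_(1 <= k <oo) g k = \sum_(1 <= k <oo) ((f k%:R)^-1)%:E)%E by [].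
  by apply: congr_lim; apply/funext => N; apply: eq_big_nat => -[].
have U0 k : 0 <= U k by rewrite mulr_ge0 ?powR_ge0 ?ltW.
have delta0 k : 0 <= delta k <= 2 * T.
  have TT : 0 <= 2 * T by rewrite mulr_ge0// ltW.
  rewrite mulr_ge0 ?powR_ge0//= ler_piMr//.
  apply: (@le_trans _ _ (1 `^ n%:R^-1)); last by rewrite powR1.
  apply: ge0_ler_powR; rewrite ?nnegrE ?invr_ge0 ?expR_ge0//.
apply: ae_matrixS (groshev_convergence m n U delta _ U0 delta0 sumUd).
move=> B [k0 hB].
exists (expR k0.+1%:R + (2 * T) ^+ n).
  by rewrite -[ltLHS]addr0 ltr_leD ?expR_gt1 ?ltr0n// exprn_ge0 ?mulr_ge0 ?ltW.
move=> Q Q0Q phi hphi N C.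
have TTn : 0 <= (2 * T) ^+ n by rewrite exprn_ge0// mulr_ge0// ltW.
have ekQ : expR k0.+1%:R <= Q by apply: le_trans Q0Q; rewrite lerDl.
have TQ : (2 * T) ^+ n <= Q by apply: le_trans Q0Q; rewrite lerDr expR_ge0.
have Qpos : 0 < Q by exact: lt_le_trans (expR_gt0 _) ekQ.
have klnQ : k0.+1%:R <= ln Q by rewrite -[leLHS]expRK ler_ln ?posrE ?expR_gt0.
have lnQ0 : 0 <= ln Q by apply: le_trans klnQ.
have [k kk0 [kQ Qk]] : exists2 k, (k0 <= k)%N & k.+1%:R <= ln Q /\ ln Q < k.+2%:R.
  have : (k0.+1 <= Num.truncn (ln Q))%N by rewrite truncn_ge_nat.
  have := truncn_itv lnQ0.
  case: (Num.truncn (ln Q)) => // k /andP[h1 h2]; rewrite ltnS => kk0.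
  by exists k.
have fQ : f k.+1%:R <= f (ln Q) by apply: f_incr => //; rewrite ltr0n.
have QE : expR (ln Q) = Q by rewrite lnK.
have phi0 : 0 < phi Q.
  by apply: lt_le_trans hphi; rewrite mulr_gt0 ?invr_gt0// (lt_le_trans (f0 k)).
pose X := phi Q `^ m%:R^-1.
pose Y := Q `^ n%:R^-1 / 2.
have X0 : 0 < X by exact: powR_gt0.
have Y0 : 0 < Y by rewrite divr_gt0// powR_gt0.
have XE : X ^+ m = phi Q by rewrite rootK// ltW.
have Y2 : 2 * Y = Q `^ n%:R^-1 by rewrite /Y; field.
have YE : (2 * Y) ^+ n = Q by rewrite Y2 rootK// ltW.
have TY : T <= Y.
  have [T2 Y2R] : 0 <= 2 * T /\ 0 <= 2 * Y.
    by split; apply: mulr_ge0 => //; exact: ltW.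
  by rewrite -(@ler_pM2l _ 2)// -(@ler_pXn2r _ n) ?nnegrE// YE.
have XP : 1 <= X * P k `^ m%:R^-1.
  apply: (ge1_of_exprn _ m); rewrite ?mulr_ge0 ?powR_ge0//.
  rewrite exprMn XE rootK ?(ltW (P0 k))//.
  apply: le_trans (ler_wpM2r (ltW (P0 k)) hphi).
  rewrite /P mulrACA -[X in X <= _]mulr1 ler_pM//.
    by rewrite mulrC ler_pdivlMr// mul1r -{1}QE ler_expR ltW.
  by rewrite ler_pdivlMr ?mul1r.
have Yd : 1 <= Y * (2 * expR (- k.+1%:R) `^ n%:R^-1).
  rewrite mulrA (mulrC Y) Y2;
  apply: (ge1_of_exprn _ n _ n0 (mulr_ge0 (powR_ge0 _ _) (powR_ge0 _ _))).
  rewrite exprMn !rootK ?expR_ge0 ?(ltW Qpos)//.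
  by rewrite -{1}QE -expRD -[leLHS]expR0 ler_expR subr_ge0.
move=> N0 CC.
apply: (solvable_of_no_small_dual m n B Q X Y phi X0 Y0 XE YE _ m0 n0 N C N0 CC).
move=> u v hu hv.
(* if u = 0, then |v| < T / Y <= 1 *)
have [u0|u0] := eqVneq u 0.
  split => //; apply/rowP => j; rewrite mxE; apply/eqP.
  have := hv j; rewrite u0 map_mx0 mul0mx add0r mxE => vj.
  have : `|(v 0 j)%:~R| < 1 :> R.
    rewrite -(ltr_pM2l Y0) mulr1; exact: lt_le_trans TY.
  rewrite -intr_norm -[1]/(1%:~R) ltr_int; apply: contraTT => v0.
  by rewrite -leNgt -gtz0_ge1 normr_gt0.
exfalso; apply: (hB k kk0 u u0).
  move=> i; apply: le_trans (ler_wpM2r (powR_ge0 _ _) (ltW (hu i))).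
  by rewrite mulrAC ler_peMl.
move=> j; exists (- v 0 j).
have := hv j; rewrite mxE [X in _ + X]mxE rmorphN opprK => hvj.
rewrite /delta -mulrA mulrCA; apply: le_trans (ler_wpM2r _ (ltW hvj)); last first.
  by rewrite mulr_ge0// powR_ge0.
by rewrite mulrAC ler_peMl.
Qed.

Theorem mainTheorem2 (R : realType) (m n : nat) (f : R -> R)
    (m_ge1 : (1 <= m)%N) (n_ge1 : (1 <= n)%N)
    (f_pos : positive_on_pos f) (f_incr : increasing_on_pos f)
    (f_sum : (\sum_(1 <= k <oo) ((f k%:R)^-1)%:E < +oo)%E) :
  (ae_matrix (fun B : 'M[R]_(m, n) =>
     forall N : nat, (0 < N)%N ->
     exists2 Q0 : R, 1 < Q0 &
     forall Q : R, Q0 <= Q ->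
     forall phi : R -> R, positive_on_pos phi -> decreasing_on_pos phi ->
     Q^-1 * f (ln Q) <= phi Q ->
     forall C : set 'cV[int]_(m + n), congruence_class N C ->
     solvable_in B N Q phi C))
  /\
  (polynomial_growth f ->
   ae_matrix (fun B : 'M[R]_(m, n) =>
     exists2 Q0 : R, 1 < Q0 &
     forall Q : R, Q0 <= Q ->
     exists N0 : nat,
     forall N : nat, (0 < N)%N -> (N0 <= N)%N ->
     forall phi : R -> R, positive_on_pos phi -> decreasing_on_pos phi ->
     phi Q <= Q^-1 * f (ln Q) `^ (- m%:R^-1) ->
     exists2 C : set 'cV[int]_(m + n), congruence_class N C &
     ~ solvable_in B N Q phi C)).
Proof.
split.
  apply: ae_matrixS (solvable_almost_everywhere R m n f m_ge1 n_ge1 f_pos f_incr f_sum).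
  move=> B [Q0 Q01 hQ] N N0; exists Q0 => // Q Q0Q phi _ _ hphi C CC.
  exact: hQ CC.
move=> _; apply: ae_matrix_all => B.
have [Q0 Q01 hQ] := unsolvable_everywhere R m n f B m_ge1 n_ge1 f_pos f_incr f_sum.
exists Q0 => // Q /hQ[N0 hN]; exists N0 => N N_gt0 NN0 phi _ _.
exact: hN.
Qed.
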